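(* For all $0<p\le q\le\infty$ there exists a constant $c_{p,q}\in(0,\infty)$ depending only on $p$ and $q$ such that for all $N,m\in\mathbb{N}$ with $1\le m< N^2$, \[ E_m\big(B_p^N,\mathcal{S}_q^N\big)\;\ge\; c_{p,q}\,\min\Big\{1,\frac{N}{m}\Big\}^{1/p-1/q}, \] where $1/\infty=0$.
   Context: $\mathbb{N}=\{1,2,\dots\}$. For $0<p\le\infty$ and $N\in\mathbb{N}$, the Schatten class $\mathcal{S}_p^N$ is the space of all real $N\times N$ matrices $A$ equipped with the (quasi-)norm $\|A\|_{\mathcal{S}_p^N}=\big(\sum_{j=1}^N\sigma_j(A)^p\big)^{1/p}$, where $\sigma_1(A)\ge\dots\ge\sigma_N(A)\ge0$ are the singular values of $A$; for $p=\infty$, $\|A\|_{\mathcal{S}_\infty^N}=\sigma_1(A)$. Its closed unit ball is $B_p^N=\{A\in\mathbb{R}^{N\times N}:\|A\|_{\mathcal{S}_p^N}\le1\}$. For $m\in\mathbb{N}$, \[ E_m\big(B_p^N,\mathcal{S}_q^N\big)=\inf_{\mathcal{A},\Delta}\ \sup_{X\in B_p^N}\|X-\Delta(\mathcal{A}(X))\|_{\mathcal{S}_q^N}, \] where the infimum is over all linear information maps $\mathcal{A}:\mathbb{R}^{N\times N}\to\mathbb{R}^m$, i.e. $\mathcal{A}(X)=(\langle A_1,X\rangle,\dots,\langle A_m,X\rangle)$ with $A_1,\dots,A_m\in\mathbb{R}^{N\times N}$ and $\langle\cdot,\cdot\rangle$ the standard inner product on $\mathbb{R}^{N\times N}$,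 and over all (arbitrary, not necessarily linear) recovery maps $\Delta:\mathbb{R}^m\to\mathbb{R}^{N\times N}$. *)

(* Defs.v *)
From HB Require Import structures.
From mathcomp Require Import all_boot all_order all_algebra.
From mathcomp Require Import all_classical all_reals all_analysis.
From mathcomp Require Import polyrcf.

Set Implicit Arguments.
Unset Strict Implicit.
Unset Printing Implicit Defensive.

Import Order.TTheory GRing.Theory Num.Theory.

Local Open Scope classical_set_scope.
Local Open Scope ring_scope.

(* The square roots of the eigenvalues of A^T A, each repeated according to its
   multiplicity as a root of the characteristic polynomial (rootsR enumerates
   the real roots without repetition), in nonincreasing order.  *)
Definition singular_values (R : realType) (N : nat) (A : 'M[R]_N) : seq R :=
  let P := char_poly (A^T *m A) in
  sort >=%R (flatten [seq nseq (mup x P) (Num.sqrt x) | x <- rootsR P]).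

(* Indices start at 0: the largest singular value is singular_value A 0.  *)
Definition singular_value (R : realType) (N : nat) (A : 'M[R]_N) (j : nat) : R :=
  nth 0 (singular_values A) j.

(* The value at p = -oo is junk: only 0 < p <= +oo is meaningful.  *)
Definition schatten_norm (R : realType) (N : nat) (p : \bar R) (A : 'M[R]_N) : R :=
  match p with
  | EFin r => (\sum_(j < N) singular_value A j `^ r) `^ r^-1
  | EPInf => singular_value A 0
  | ENInf => 0
  end.

Definition schatten_ball (R : realType) (N : nat) (p : \bar R) : set 'M[R]_N :=
  [set A | schatten_norm p A <= 1].

Definition mx_inner (R : realType) (N : nat) (A X : 'M[R]_N) : R :=
  \sum_(i < N) \sum_(j < N) A i j * X i j.

Definition info_map (R : realType) (N m : nat) (A : 'I_m -> 'M[R]_N)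
    (X : 'M[R]_N) : 'rV[R]_m :=
  \row_(k < m) mx_inner (A k) X.

(* Suprema and infima are taken in \bar R because the worst-case error of an
   arbitrary recovery map may be infinite.  *)
Definition worst_case_error (R : realType) (N m : nat) (p q : \bar R)
    (A : 'I_m -> 'M[R]_N) (Delta : 'rV[R]_m -> 'M[R]_N) : \bar R :=
  ereal_sup [set (schatten_norm q (X - Delta (info_map A X)))%:E
            | X in @schatten_ball R N p].

Definition minimal_error (R : realType) (N m : nat) (p q : \bar R) : \bar R :=
  ereal_inf [set e | exists (A : 'I_m -> 'M[R]_N) (Delta : 'rV[R]_m -> 'M[R]_N),
                       e = worst_case_error p q A Delta].

(* Main.v *)
Require Import Defs.
From mathcomp Require Import all_boot all_order all_algebra.
From mathcomp Require Import all_classical all_reals all_analysis.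
From mathcomp Require Import polyrcf complex ring lra zify.

Import Order.TTheory GRing.Theory Num.Theory.

Local Open Scope ring_scope.

(** The bound comes from matrices of low rank in the kernel of the information
    map.  Put [r = m %/ N + 1].  The matrices supported on the first [r] columns
    form a space of dimension [N * r > m], so the information map kills some
    [X != 0] of rank at most [r] ([exists_low_rank_kernel]).  At most [r] singular
    values of [X] are nonzero, hence by the power mean inequality
    [schatten_norm p X <= r `^ (1/p - 1/q) * schatten_norm q X]
    ([schatten_norm_rank_le]); after scaling, [schatten_norm p X = 1].

    The points [X] and [- X] of the unit ball carry the same (zero) information,
    so they are recovered by the same matrix [Y], and
    [X = ((X - Y) - (- X - Y)) / 2].  A quasi-triangle inequality
    ([schatten_norm_half_sub]) bounds the larger of the two errors from below by
    a multiple of [schatten_norm q X] that depends on [q] only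
    ([worst_case_error_ge]).  Since [min 1 (N/m) <= 2 / r] ([min_ratio_le]),
    this is the claimed bound.

    For all [q > 0] at once, the quasi-triangle inequality follows from Weyl's
    inequality for singular values, in the form
    [s_(i+j) ((A - B) / 2) <= max (s_i A) (s_j B)].  It is proved by comparing
    the quadratic forms of the Gram matrices on a common nonzero vector of
    spectral subspaces ([weyl_gram]); the parallelogram law stands in for the
    triangle inequality of the Euclidean norm.  The spectral theorem is applied
    over [R[i]], which is harmless because only quadratic forms are compared. *)

Local Open Scope sesquilinear_scope.
Local Open Scope complex_scope.

(** * Singular values and the spectral decomposition of the Gram matrix *)

(** A split polynomial gives back the list of its roots when each real root is
    repeated as often as its multiplicity says. *)
Lemma perm_roots_mup (F : rcfType) (s : seq F) (P : {poly F}) :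
  P = \prod_(x <- s) ('X - x%:P) ->
  perm_eq (flatten [seq nseq (mup x P) x | x <- rootsR P]) s.
Proof.
move=> PE; have P0 : P != 0 by rewrite PE; exact/monic_neq0/monic_prod_XsubC.
have mupP x : mup x P = count_mem x s by rewrite PE mu_prod_XsubC.
have memP x : (x \in rootsR P) = (x \in s).
  by rewrite -(roots_on_rootsR P0) /= PE root_prod_XsubC.
have uP : uniq (rootsR P) by exact: (sorted_uniq lt_trans ltxx (sorted_roots _ _ _)).
apply/allP => y _ /=; rewrite count_flatten -map_comp.
have E x : (count_mem y \o fun x => nseq (mup x P) x) x = ((x == y) * count_mem x s)%N.
  by rewrite /= count_nseq mupP.
rewrite (eq_map E) sumnE big_map.
have [yP|yP] := boolP (y \in rootsR P); last first.
  rewrite big_seq big1; last by move=> x xP; case: eqP yP => // <-; rewrite xP.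
  by rewrite memP in yP; rewrite (count_memPn yP).
rewrite (bigD1_seq y) //= eqxx mul1n big1 ?addn0 // => x /negPf ->.
by rewrite mul0n.
Qed.

Lemma mulmx_adjoint_diag (C : numClosedFieldType) (k n : nat)
    (V : 'M[C]_(k, n)) (i : 'I_k) :
  (V *m V^t*) i i = \sum_j `|V i j| ^+ 2.
Proof. by rewrite mxE; apply: eq_bigr => j _; rewrite !mxE -normCK. Qed.

(** The quadratic form of a Gram matrix, evaluated on row vectors, is a squared
    Euclidean norm. *)
Lemma gram_form (R : rcfType) (k N : nat) (A : 'M[R]_N) (W : 'M[R[i]]_(k, N)) :
  let V := W *m (map_mx (real_complex R) A)^T in
  W *m map_mx (real_complex R) (A^T *m A) *m W^t* = V *m V^t*.
Proof.
have realC : map_mx Num.conj (map_mx (real_complex R) A) = map_mx (real_complex R) A.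
  by apply/matrixP => i j; rewrite !mxE conj_Creal //; apply/complex_realP; exists (A i j).
by move=> V; rewrite /V trmx_mul trmxK !map_mxM realC map_trmx !mulmxA.
Qed.

Lemma char_poly_unitary (C : numClosedFieldType) (n : nat) (P : 'M[C]_n)
    (D : 'rV[C]_n) : P \is unitarymx ->
  char_poly (P^t* *m diag_mx D *m P) = \prod_i ('X - (D 0 i)%:P).
Proof.
move=> PU.
have -> : \prod_i ('X - (D 0 i)%:P) = char_poly (diag_mx D).
  rewrite char_poly_trig ?diag_mx_is_trig //.
  by apply: eq_bigr => i _; rewrite mxE eqxx.
have PP : map_mx polyC (P^t*) *m map_mx polyC P = 1%:M.
  by rewrite -map_mxM -invmx_unitary // mulVmx ?unitarymx_unit // map_mx1.
rewrite /char_poly /char_poly_mx !map_mxM.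
have -> : 'X%:M - map_mx polyC (P^t*) *m map_mx polyC (diag_mx D) *m map_mx polyC P
   = map_mx polyC (P^t*) *m ('X%:M - map_mx polyC (diag_mx D)) *m map_mx polyC P.
  rewrite mulmxBr mulmxBl; congr (_ - _).
  by rewrite scalar_mxC -mulmxA PP mulmx1.
by rewrite !det_mulmx mulrAC -det_mulmx PP det1 mul1r.
Qed.

(** The Gram matrix of [A] is unitarily diagonalizable over [R[i]] with real
    nonnegative eigenvalues [d], and the singular values are the sorted square
    roots of these eigenvalues. *)
Lemma gram_spectral (R : realType) (N : nat) (A : 'M[R]_N) :
  exists (P : 'M[R[i]]_N) (d : 'I_N -> R),
    [/\ P \is unitarymx,
        map_mx (real_complex R) (A^T *m A) =
          P^t* *m diag_mx (\row_i (d i)%:C) *m P,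
        forall i, 0 <= d i
      & singular_values A = sort >=%R [seq Num.sqrt (d i) | i <- enum 'I_N]].
Proof.
set M := A^T *m A; pose MC := map_mx (real_complex R) M.
have Msym : MC \is symmetricmx.
  by apply/is_hermitianmxP; rewrite expr0 scale1r map_mx_id // map_trmx trmx_mul trmxK.
have Mreal : MC \is a realmx.
  by apply/mxOverP => i j; rewrite mxE; apply/complex_realP; exists (M i j).
have Mherm := realsym_hermsym Msym Mreal.
have /orthomx_spectralP Meq := hermitian_normalmx Mherm.
have /mxOverP dreal := hermitian_spectral_diag_real Mherm.
set P := spectralmx MC in Meq; set D := spectral_diag MC in Meq dreal.
have PU : P \is unitarymx by exact: spectral_unitarymx.
rewrite invmx_unitary // in Meq.
pose d i := complex.Re (D 0 i).
have DE : D = \row_i (d i)%:C.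
  by apply/rowP => i; rewrite mxE /d RRe_real.
exists P, d; split => //; first by rewrite -DE.
- move=> i; rewrite -lecR /d RRe_real //.
  have -> : D 0 i = (P *m MC *m P^t*) i i.
    rewrite Meq !mulmxA (unitarymxP PU) mul1mx mulmxtVK //.
    by rewrite mxE eqxx.
  rewrite gram_form mulmx_adjoint_diag.
  by apply: sumr_ge0 => j _; rewrite exprn_ge0.
- have cp : char_poly M = \prod_(x <- [seq d i | i <- enum 'I_N]) ('X - x%:P).
    apply: (@map_poly_inj _ _ (real_complex R)).
    rewrite map_char_poly -/MC Meq char_poly_unitary // rmorph_prod /=.
    rewrite big_map big_enum /=; apply: eq_bigr => i _.
    by rewrite rmorphB /= map_polyX map_polyC /= /d RRe_real.
  rewrite /singular_values -/M cp.
  set s := [seq d i | i <- enum 'I_N].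
  set Q := \prod_(x <- s) _; have Qs := perm_roots_mup _ s Q erefl.
  have -> : [seq nseq (mup x Q) (Num.sqrt x) | x <- rootsR Q]
     = map (map Num.sqrt) [seq nseq (mup x Q) x | x <- rootsR Q].
    by rewrite -map_comp; apply: eq_map => x /=; rewrite map_nseq.
  rewrite -map_flatten; apply/perm_sortP.
  - by move=> x y; exact: le_total.
  - by move=> x y z /= yx xz; exact: le_trans xz yx.
  - by move=> x y /= /andP[xy yx]; apply/eqP; rewrite eq_le xy yx.
  - by rewrite [X in perm_eq _ X]map_comp; exact: perm_map.
Qed.

Lemma singular_values_sorted (R : realType) (N : nat) (A : 'M[R]_N) :
  sorted >=%R (singular_values A).
Proof. by apply: sort_sorted => x y; exact: le_total. Qed.

Lemma size_singular_values (R : realType) (N : nat) (A : 'M[R]_N) :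
  size (singular_values A) = N.
Proof.
have [P [d [_ _ _ ->]]] := gram_spectral R N A.
by rewrite size_sort size_map size_enum_ord.
Qed.

Lemma singular_value_ge0 (R : realType) (N : nat) (A : 'M[R]_N) (j : nat) :
  0 <= singular_value A j.
Proof.
have [jN|Nj] := ltnP j N; last first.
  by rewrite /singular_value nth_default // size_singular_values.
have : singular_value A j \in singular_values A.
  by rewrite mem_nth // size_singular_values.
have [P [d [_ _ _ ->]]] := gram_spectral R N A.
by rewrite mem_sort => /mapP[k _ ->]; exact: sqrtr_ge0.
Qed.

Lemma singular_value_noninc (R : realType) (N : nat) (A : 'M[R]_N) (i j : nat) :
  (i <= j)%N -> singular_value A j <= singular_value A i.
Proof.
move=> ij; have [jN|Nj] := ltnP j N; last first.
  rewrite [leLHS]/singular_value nth_default ?size_singular_values //.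
  exact: singular_value_ge0.
have tr : transitive (>=%R : rel R) by move=> x y z /= yx xz; exact: le_trans xz yx.
apply: (sorted_leq_nth tr _ 0 (singular_values_sorted R N A)) => //.
- by move=> x /=.
- by rewrite inE size_singular_values (leq_ltn_trans ij).
- by rewrite inE size_singular_values.
Qed.

(** The position of a value in the nonincreasing list of singular values is
    controlled by the number of singular values above it; this lemma and the
    next one turn inequalities between singular values into counting. *)
Lemma count_singular_value (R : realType) (N : nat) (A : 'M[R]_N) (k : nat) :
  (count (> singular_value A k) (singular_values A) <= k)%N.
Proof.
set s := singular_values A.
rewrite -[X in count _ X](cat_take_drop k) count_cat.
have /eqP -> : count (> singular_value A k) (drop k s) == 0%N.
  rewrite -leqn0 leqNgt -has_count; apply/hasPn => x /(nthP 0)[j jlt <-].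
  by rewrite nth_drop -leNgt /= singular_value_noninc ?leq_addr.
rewrite addn0; apply: leq_trans (count_size _ _) _.
by rewrite size_take_min geq_minl.
Qed.

Lemma count_lt_singular_value (R : realType) (N : nat) (A : 'M[R]_N) (k : nat)
    (t : R) :
  0 <= t -> t < singular_value A k ->
  (k < count (> t) (singular_values A))%N.
Proof.
move=> t0 tk; set s := singular_values A.
have ks : (k < size s)%N.
  rewrite ltnNge; apply/negP => sk; move: tk.
  by rewrite /singular_value nth_default // ltNge t0.
rewrite -[X in count _ X](cat_take_drop k.+1) count_cat.
suff /eqP -> : count (> t) (take k.+1 s) == k.+1 by exact: leq_addr.
rewrite -[X in _ == X](_ : size (take k.+1 s) = _); last by rewrite size_takel.
rewrite -all_count; apply/allP => x /(nthP 0)[j]; rewrite size_takel // => jk <-.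
by rewrite nth_take // (lt_le_trans tk) // singular_value_noninc.
Qed.

Lemma count_gram_eigenvalues (R : realType) (N : nat) (A : 'M[R]_N)
    (d : 'I_N -> R) (t : R) :
  (forall i, 0 <= d i) -> 0 <= t ->
  singular_values A = sort >=%R [seq Num.sqrt (d i) | i <- enum 'I_N] ->
  count (> t) (singular_values A) = #|[set i | t ^+ 2 < d i]|.
Proof.
move=> d0 t0 ->; rewrite count_sort count_map -sum1_count big_enum_cond /=.
rewrite sum1dep_card; apply: eq_card => i; rewrite !inE.
have [di0|di0] := eqVneq (d i) 0.
  by rewrite di0 sqrtr0 !ltNge t0 exprn_ge0.
by rewrite -[RHS]ltr_sqrt ?lt0r ?di0 ?d0 // sqrtr_sqr ger0_norm.
Qed.

(** * Weyl's inequality *)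

(** The squared Euclidean norm of the image of the complex vector [v] under [A];
    vectors are rows, so that the image is [v *m A^T]. *)
Definition gram_energy (R : realType) (N : nat) (A : 'M[R]_N) (v : 'rV[R[i]]_N) :
    R[i] :=
  \sum_j `|(v *m (map_mx (real_complex R) A)^T) 0 j| ^+ 2.

Lemma gram_energyE (R : realType) (N : nat) (A : 'M[R]_N) (v : 'rV[R[i]]_N) :
  gram_energy R N A v =
    (v *m map_mx (real_complex R) (A^T *m A) *m v^t*) 0 0.
Proof. by rewrite gram_form mulmx_adjoint_diag. Qed.

Lemma gram_energy_ge0 (R : realType) (N : nat) (A : 'M[R]_N) (v : 'rV[R[i]]_N) :
  0 <= gram_energy R N A v.
Proof. by apply: sumr_ge0 => j _; rewrite exprn_ge0. Qed.

Lemma unitary_diag_form (C : numClosedFieldType) (N : nat) (P : 'M[C]_N)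
    (D : 'rV[C]_N) (v : 'rV[C]_N) :
  (v *m (P^t* *m diag_mx D *m P) *m v^t*) 0 0 =
    \sum_k D 0 k * `|(v *m P^t*) 0 k| ^+ 2.
Proof.
rewrite !mulmxA -mulmxA.
have -> : P *m v^t* = (v *m P^t*)^t* by rewrite trmx_mul map_mxM trmxCK.
rewrite mul_mx_diag mxE; apply: eq_bigr => k _.
by rewrite !mxE normCK mulrAC mulrC mulrA.
Qed.

Lemma gram_energy_coord (R : realType) (N : nat) (A : 'M[R]_N)
    (P : 'M[R[i]]_N) (d : 'I_N -> R) (v : 'rV[R[i]]_N) :
  map_mx (real_complex R) (A^T *m A) = P^t* *m diag_mx (\row_i (d i)%:C) *m P ->
  gram_energy R N A v = \sum_k (d k)%:C * `|(v *m P^t*) 0 k| ^+ 2.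
Proof.
move=> AE; rewrite gram_energyE AE unitary_diag_form.
by under eq_bigr => k _ do rewrite mxE.
Qed.

Lemma norm_coord (C : numClosedFieldType) (N : nat) (P : 'M[C]_N) (v : 'rV[C]_N) :
  P \is unitarymx ->
  \sum_k `|v 0 k| ^+ 2 = \sum_k `|(v *m P^t*) 0 k| ^+ 2.
Proof.
move=> PU; rewrite -!mulmx_adjoint_diag trmx_mul map_mxM trmxCK.
by rewrite mulmxA mulmxKtV.
Qed.

(** The vanishing of the coordinates of [v *m Q] with index in [S] amounts to
    [#|S|] linear conditions on [v], packed into a matrix with [#|S|] columns. *)
Lemma colsub_enum_eq0 (F : fieldType) (N : nat) (S : {set 'I_N}) (Q : 'M[F]_N)
    (v : 'rV[F]_N) :
  v *m colsub (fun k : 'I_#|S| => enum_val k) Q = 0 ->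
  forall k, k \in S -> (v *m Q) 0 k = 0.
Proof.
move=> v0 k kS; have := congr1 (fun w : 'rV_#|S| => w 0 (enum_rank_in kS k)) v0.
rewrite [X in _ = X]mxE => <-; rewrite !mxE; apply: eq_bigr => l _.
by rewrite mxE enum_rankK_in.
Qed.

(** One half of the Courant-Fischer principle: [i] linear conditions on [v]
    suffice to make [v] orthogonal to all eigenvectors whose singular value
    exceeds the one of index [i].  The conditions are the columns of [K]. *)
Lemma gram_energy_le (R : realType) (N : nat) (A : 'M[R]_N) (i : nat) :
  exists k (K : 'M[R[i]]_(N, k)), (k <= i)%N /\
    forall v : 'rV_N, v *m K = 0 ->
      gram_energy R N A v <= (singular_value A i ^+ 2)%:C * \sum_j `|v 0 j| ^+ 2.
Proof.
have [P [d [PU AE d0 sE]]] := gram_spectral R N A.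
have := count_singular_value R N A i.
rewrite (count_gram_eigenvalues _ _ _ _ _ d0 _ sE) ?singular_value_ge0 //.
set S := [set _ | _] => Si.
exists #|S|, (colsub (fun k : 'I_#|S| => enum_val k) (P^t*)); split => // v v0.
rewrite (gram_energy_coord _ _ _ _ _ _ AE) (norm_coord _ _ _ _ PU) mulr_sumr.
apply: ler_sum => k _; have [kS|kS] := boolP (k \in S).
  by rewrite (colsub_enum_eq0 _ _ _ _ _ v0 _ kS) normr0 expr0n /= !mulr0.
apply: ler_wpM2r; first by rewrite exprn_ge0.
by rewrite lecR; move: kS; rewrite inE -leNgt.
Qed.

(** The other half: if [t] lies below the singular value of index [i], then fewer
    than [N - i] linear conditions confine [v] to the span of the eigenvectors
    whose singular value exceeds [t]. *)
Lemma gram_energy_gt (R : realType) (N : nat) (A : 'M[R]_N) (i : nat) (t : R) :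
  0 <= t -> t < singular_value A i ->
  exists k (K : 'M[R[i]]_(N, k)), (k + i < N)%N /\
    forall v : 'rV_N, v != 0 -> v *m K = 0 ->
      (t ^+ 2)%:C * \sum_j `|v 0 j| ^+ 2 < gram_energy R N A v.
Proof.
move=> t0 ti.
have [P [d [PU AE d0 sE]]] := gram_spectral R N A.
have := count_lt_singular_value R N A i t t0 ti.
rewrite (count_gram_eigenvalues _ _ _ _ _ d0 _ sE) //.
set S := [set _ | _] => Si.
exists #|~: S|, (colsub (fun k : 'I_#|~: S| => enum_val k) (P^t*)); split.
  by have := cardsC S; rewrite card_ord; lia.
move=> v vN0 v0.
rewrite (gram_energy_coord _ _ _ _ _ _ AE) (norm_coord _ _ _ _ PU) mulr_sumr.
set y := v *m P^t*.
have : y != 0.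
  apply: contra_neq vN0 => y0.
  by rewrite -[v](mulmxKtV v PU) // -/y y0 mul0mx.
move=> /rV0Pn[k0 yk0].
have yS k : k \notin S -> y 0 k = 0.
  by move=> kS; apply: (colsub_enum_eq0 _ _ _ _ _ v0); rewrite inE.
have k0S : k0 \in S by apply: contraNT yk0 => /yS ->.
rewrite [ltLHS](bigD1 k0) //= [ltRHS](bigD1 k0) //=; apply: ltr_leD.
  by rewrite ltr_pM2r ?exprn_gt0 ?normr_gt0 // ltcR; move: k0S; rewrite inE.
apply: ler_sum => k _; have [kS|kS] := boolP (k \in S).
  by apply: ler_wpM2r; rewrite ?exprn_ge0 // lecR ltW //; move: kS; rewrite inE.
by rewrite yS // normr0 expr0n /= !mulr0.
Qed.

Lemma exists_kernel (F : fieldType) (n k : nat) (K : 'M[F]_(n, k)) :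
  (k < n)%N -> exists2 v : 'rV_n, v != 0 & v *m K = 0.
Proof.
move=> kn; have : kermx K != 0.
  by rewrite -mxrank_eq0 mxrank_ker -lt0n subn_gt0 (leq_ltn_trans (rank_leq_col K)).
by move=> /rowV0Pn[v /sub_kermxP vK v0]; exists v.
Qed.

(** If the Gram form of [X] is dominated by [a] times that of [A] plus [b] times
    that of [B], the defect being a Gram form too, then the squared singular
    values obey Weyl's inequality with the same weights. *)
Lemma weyl_gram (R : realType) (N : nat) (X Q A B : 'M[R]_N) (a b : R) (i j : nat) :
  0 <= a -> 0 <= b ->
  X^T *m X + Q^T *m Q = a *: (A^T *m A) + b *: (B^T *m B) ->
  singular_value X (i + j) ^+ 2 <=
    a * singular_value A i ^+ 2 + b * singular_value B j ^+ 2.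
Proof.
move=> a0 b0 E; set t2 := leRHS.
have t20 : 0 <= t2 by rewrite addr_ge0 // mulr_ge0 ?exprn_ge0 ?singular_value_ge0.
rewrite leNgt; apply/negP => tX.
have {}tX : Num.sqrt t2 < singular_value X (i + j).
  rewrite -(ger0_norm (singular_value_ge0 _ _ X (i + j))) -sqrtr_sqr.
  by rewrite ltr_sqrt // (le_lt_trans t20).
have [kX [KX [kXN KXP]]] := gram_energy_gt R N X (i + j) _ (sqrtr_ge0 t2) tX.
have [kA [KA [kAi KAP]]] := gram_energy_le R N A i.
have [kB [KB [kBj KBP]]] := gram_energy_le R N B j.
(* The three families have fewer than (N - (i + j)) + i + j = N conditions. *)
have [|v v0] := exists_kernel _ _ _ (row_mx KX (row_mx KA KB)).
  by lia.
rewrite !mul_mx_row => /eqP; rewrite !row_mx_eq0 => /and3P[/eqP vX /eqP vA /eqP vB].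
have := KXP v v0 vX; rewrite sqr_sqrtr // => /lt_geF/negP; apply.
have EE : gram_energy R N X v + gram_energy R N Q v
    = a%:C * gram_energy R N A v + b%:C * gram_energy R N B v.
  rewrite !gram_energyE.
  have addE (U V : 'M[R[i]]_1) : (U + V) 0 0 = U 0 0 + V 0 0 by rewrite mxE.
  have scaleE c (U : 'M[R[i]]_1) : (c *: U) 0 0 = c * U 0 0 by rewrite mxE.
  rewrite -addE -mulmxDl -mulmxDr -map_mxD E map_mxD !map_mxZ mulmxDr mulmxDl.
  by rewrite addE -!scalemxAr -!scalemxAl !scaleE.
apply: (@le_trans _ _ (gram_energy R N X v + gram_energy R N Q v)).
  by rewrite lerDl gram_energy_ge0.
rewrite EE rmorphD (rmorphM _ a) (rmorphM _ b) /= mulrDl -!mulrA.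
have toC_ge0 c : 0 <= c -> 0 <= c%:C :> R[i] by move=> c0; rewrite -lecR in c0.
by apply: lerD; apply: ler_wpM2l; rewrite ?toC_ge0 ?KAP ?KBP.
Qed.

Lemma gram_parallelogram (R : realType) (N : nat) (A B : 'M[R]_N) :
  (2^-1 *: (A - B))^T *m (2^-1 *: (A - B)) +
  (2^-1 *: (A + B))^T *m (2^-1 *: (A + B)) =
  2^-1 *: (A^T *m A) + 2^-1 *: (B^T *m B).
Proof.
apply/matrixP => k l; rewrite !mxE !mulr_sumr -!big_split /=.
by apply: eq_bigr => j _; rewrite !mxE; field.
Qed.

Lemma singular_value_half_sub (R : realType) (N : nat) (A B : 'M[R]_N)
    (i j : nat) :
  singular_value (2^-1 *: (A - B)) (i + j) <=
    Num.max (singular_value A i) (singular_value B j).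
Proof.
have h0 : 0 <= 2^-1 :> R by rewrite invr_ge0.
have := weyl_gram _ _ _ _ _ _ _ _ i j h0 h0 (gram_parallelogram R N A B).
set x := singular_value _ _; set a := singular_value A i.
set b := singular_value B j; set m := Num.max a b => xle.
have a0 : 0 <= a := singular_value_ge0 _ _ _ _.
have b0 : 0 <= b := singular_value_ge0 _ _ _ _.
have x0 : 0 <= x := singular_value_ge0 _ _ _ _.
have am : a <= m by rewrite le_max lexx.
have bm : b <= m by rewrite le_max lexx orbT.
rewrite -ler_sqr ?nnegrE ?(le_trans a0 am) //.
have : a ^+ 2 <= m ^+ 2 by rewrite ler_sqr ?nnegrE ?(le_trans a0 am).
have : b ^+ 2 <= m ^+ 2 by rewrite ler_sqr ?nnegrE ?(le_trans a0 am).
by move: xle; lra.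
Qed.

(** Weyl's inequality with one matrix and no defect. *)
Lemma singular_valueZ_le (R : realType) (N : nat) (c : R) (A : 'M[R]_N) (j : nat) :
  0 <= c -> singular_value (c *: A) j <= c * singular_value A j.
Proof.
move=> c0.
pose O : 'M[R]_N := 0.
have E : (c *: A)^T *m (c *: A) + O^T *m O =
    c ^+ 2 *: (A^T *m A) + 0 *: (O^T *m O).
  rewrite mulmx0 scaler0 !addr0; apply/matrixP => k l; rewrite !mxE mulr_sumr.
  by apply: eq_bigr => i _; rewrite !mxE; ring.
have := weyl_gram R N _ _ _ _ _ _ j 0 (sqr_ge0 c) (lexx 0) E.
rewrite addn0 mul0r addr0 -exprMn ler_sqr // nnegrE ?mulr_ge0 //;
  exact: singular_value_ge0.
Qed.

Lemma singular_valueZ (R : realType) (N : nat) (c : R) (A : 'M[R]_N) (j : nat) :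
  0 < c -> singular_value (c *: A) j = c * singular_value A j.
Proof.
move=> c0; apply/eqP; rewrite eq_le (singular_valueZ_le _ _ _ _ _ (ltW c0)) /=.
rewrite -ler_pdivlMl // -[X in singular_value X _]scale1r -(mulVf (lt0r_neq0 c0)).
by rewrite -scalerA singular_valueZ_le // invr_ge0 ltW.
Qed.

Lemma singular_valuesN (R : realType) (N : nat) (A : 'M[R]_N) :
  singular_values (- A) = singular_values A.
Proof.
rewrite /singular_values; suff -> : (- A)^T *m (- A) = A^T *m A by [].
apply/matrixP => k l; rewrite !mxE; apply: eq_bigr => i _.
by rewrite !mxE mulrNN.
Qed.

Lemma singular_value_rank (R : realType) (N : nat) (A : 'M[R]_N) (j : nat) :
  (\rank A <= j)%N -> singular_value A j = 0.
Proof.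
move=> rj; apply/eqP; rewrite eq_le singular_value_ge0 andbT leNgt.
apply/negP => /(gram_energy_gt _ _ _ _ _ (lexx 0))[k [K [kN KP]]].
(* The columns of E are \rank A conditions under which A maps v to zero. *)
pose E := (map_mx (real_complex R) (row_base A))^T.
have [|v v0] := exists_kernel _ _ _ (row_mx K E); first by lia.
rewrite mul_mx_row => /eqP; rewrite row_mx_eq0 => /andP[/eqP vK /eqP vE].
have := KP v v0 vK.
rewrite expr0n /= mul0r /gram_energy -[X in map_mx _ X]mulmx_base.
rewrite map_mxM trmx_mul mulmxA vE mul0mx big1 ?ltxx // => l _.
by rewrite mxE normr0 expr0n.
Qed.

(** If the largest singular value vanishes then so does the Gram form, in
    particular on the standard basis, where it gives the norms of the columns. *)
Lemma singular_value0_gt0 (R : realType) (N : nat) (A : 'M[R]_N) :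
  A != 0 -> 0 < singular_value A 0.
Proof.
move=> A0; rewrite lt0r singular_value_ge0 andbT; apply: contra_neq A0 => s0.
have [k [K [k0 KP]]] := gram_energy_le R N A 0.
have {KP} e0 v : gram_energy R N A v = 0.
  apply/eqP; rewrite eq_le gram_energy_ge0 andbT.
  have := KP v; rewrite s0 expr0n mul0r; apply.
  by apply/rowP => l; have := leq_trans (ltn_ord l) k0.
apply/matrixP => i j; rewrite mxE.
have := e0 (delta_mx 0 j) => /eqP; rewrite psumr_eq0 => [|? _]; last exact: exprn_ge0.
move=> /allP/(_ i); rewrite mem_index_enum => /(_ isT).
by rewrite -rowE !mxE sqrf_eq0 normr_eq0 => /eqP/complexI.
Qed.

Lemma singular_valueN (R : realType) (N : nat) (A : 'M[R]_N) (j : nat) :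
  singular_value (- A) j = singular_value A j.
Proof. by rewrite /singular_value singular_valuesN. Qed.

Local Close Scope complex_scope.
Local Close Scope sesquilinear_scope.

(** * Schatten norms *)

Lemma schatten_normN (R : realType) (N : nat) (p : \bar R) (A : 'M[R]_N) :
  schatten_norm p (- A) = schatten_norm p A.
Proof.
by rewrite /schatten_norm (funext (singular_valueN R N A)).
Qed.

Lemma schatten_normZ (R : realType) (N : nat) (p : \bar R) (c : R) (A : 'M[R]_N) :
  (0 < p)%E -> 0 < c -> schatten_norm p (c *: A) = c * schatten_norm p A.
Proof.
move=> p0 c0.
have E : singular_value (c *: A) = fun j => c * singular_value A j.
  by apply/funext => j; exact: singular_valueZ.
have := singular_value_ge0 R N A; rewrite /schatten_norm E.
move: (singular_value A) => s s0; case: p p0 => [r| |] //= r0.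
have rN0 : r != 0 by rewrite gt_eqF.
have -> : \sum_(j < N) (c * s j) `^ r = c `^ r * \sum_(j < N) s j `^ r.
  by rewrite mulr_sumr; apply: eq_bigr => j _; rewrite powRM // ltW.
have S0 : 0 <= \sum_(j < N) s j `^ r by apply: sumr_ge0 => j _; exact: powR_ge0.
by rewrite powRM ?powR_ge0 // -powRrM divff // powRr1 ?ltW.
Qed.

Lemma schatten_norm_gt0 (R : realType) (N : nat) (p : \bar R) (A : 'M[R]_N) :
  (0 < p)%E -> A != 0 -> 0 < schatten_norm p A.
Proof.
move=> p0 /singular_value0_gt0 s0; case: p p0 => [r| |] //= _.
case: N A s0 => [|N] A s0.
  by move: s0; rewrite /singular_value nth_default ?size_singular_values ?ltxx.
apply: powR_gt0; rewrite big_ord_recl; apply: ltr_wpDr.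
  by apply: sumr_ge0 => i _; exact: powR_ge0.
exact: powR_gt0.
Qed.

(** The graph of the concave function [u `^ t] lies below its tangent at [1];
    this is Young's inequality with one factor equal to [1]. *)
Lemma powR_le_tangent (R : realType) (u t : R) :
  0 <= u -> 0 < t <= 1 -> u `^ t <= t * u + (1 - t).
Proof.
move=> u0 /andP[t0]; rewrite le_eqVlt => /predU1P[->|t1].
  by rewrite powRr1 // mul1r subrr addr0.
have := @conjugate_powR R (u `^ t) 1 t^-1 (1 - t)^-1 (powR_ge0 _ _) ler01.
rewrite !invr_gt0 subr_gt0 !invrK => /(_ t0 t1).
rewrite mulr1 powR1 mul1r -powRrM divff ?gt_eqF // powRr1 // mulrC [t + _]addrC.
by rewrite subrK; apply.
Qed.

(** The power mean inequality for a family supported on a set [D]. *)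
Lemma power_mean (R : realType) (I : finType) (D : {set I}) (a : I -> R) (t : R) :
  (forall i, 0 <= a i) -> (forall i, i \notin D -> a i = 0) -> 0 < t <= 1 ->
  \sum_i a i `^ t <= #|D|%:R `^ (1 - t) * (\sum_i a i) `^ t.
Proof.
move=> a0 aD t01; have /andP[t0 t1] := t01; set T := \sum_i a i.
have T0 : 0 <= T by apply: sumr_ge0.
have sumD (f : R -> R) : f 0 = 0 -> \sum_i f (a i) = \sum_(i in D) f (a i).
  move=> f0; rewrite [RHS]big_mkcond /=; apply: eq_bigr => i _.
  by case: ifPn => // /aD ->.
have [T00|TN0] := eqVneq T 0.
  rewrite big1 ?mulr_ge0 ?powR_ge0 // => i _.
  have /eqP := T00; rewrite psumr_eq0 // => /allP/(_ i); rewrite mem_index_enum.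
  by move=> /(_ isT)/eqP ->; rewrite powR0 // gt_eqF.
have Tgt : 0 < T by rewrite lt0r TN0.
have D0 : 0 < #|D|%:R :> R.
  rewrite ltr0n lt0n; apply: contra_neq TN0 => /eqP; rewrite cards_eq0 => /eqP DE.
  by apply: big1 => i _; apply: aD; rewrite DE inE.
set n : R := #|D|%:R in D0 *.
(* The tangent bound is summed over D after normalizing the mean over D to 1. *)
have key : (n / T) `^ t * (\sum_i a i `^ t) <= n.
  rewrite (sumD (fun x => x `^ t)) ?powR0 ?gt_eqF // mulr_sumr.
  apply: (@le_trans _ _ (\sum_(i in D) (t * (n / T * a i) + (1 - t)))).
    apply: ler_sum => i _; rewrite -powRM ?divr_ge0 ?(ltW D0) //.
    by apply: powR_le_tangent => //; rewrite !mulr_ge0 ?invr_ge0 ?(ltW D0).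
  rewrite big_split /= -!mulr_sumr -(sumD id) // -/T divfK // sumr_const.
  by rewrite -[_ *+ _]mulr_natl -/n; nra.
have nT0 : 0 < (n / T) `^ t by rewrite powR_gt0 // divr_gt0.
rewrite -(ler_pM2l nT0) (le_trans key) // mulrCA -powRM ?divr_ge0 ?(ltW D0) //.
by rewrite divfK // -powRD ?subrK ?powRr1 ?(ltW D0) //; apply/implyP => _; exact: lt0r_neq0.
Qed.

Lemma sum_half_le (R : numDomainType) (N : nat) (f : nat -> R) :
  (forall k, 0 <= f k) ->
  \sum_(j < N) f j./2 <= 2 * \sum_(k < N) f k.
Proof.
move=> f0; have -> : 2 * \sum_(k < N) f k = \sum_(j < N.*2) f j./2.
  elim: N => [|N IH]; first by rewrite !big_ord0 mulr0.
  rewrite doubleS !big_ord_recr /= mulrDr IH doubleK uphalf_double -addrA.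
  by rewrite mulr_natl.
rewrite -!(big_mkord xpredT (fun j => f j./2)).
rewrite [leRHS](@big_cat_nat _ _ _ N) //= ?lerDl ?sumr_ge0 //.
by rewrite -addnn leq_addr.
Qed.

(** A quasi-triangle inequality whose constant depends on [q] only.  Each singular
    value of [A] and of [B] is used for two consecutive indices, which costs a
    factor [2] in the sums of powers. *)
Lemma schatten_norm_half_sub (R : realType) (q : \bar R) :
  (0 < q)%E -> exists c : R, 0 < c /\
    forall (N : nat) (A B : 'M[R]_N),
      c * schatten_norm q (2^-1 *: (A - B)) <=
        Num.max (schatten_norm q A) (schatten_norm q B).
Proof.
case: q => [q| |] // q0; last first.
  exists 1; split => // N A B; rewrite mul1r /=.
  exact: (singular_value_half_sub R N A B 0 0).
have {}q0 : 0 < q by [].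
(* The factor 4 is 2 from sum_half_le times 2 from a sum of two terms being at
   most twice the larger one. *)
exists (4 `^ q^-1)^-1; split; first by rewrite invr_gt0 powR_gt0.
move=> N A B; rewrite ler_pdivrMl ?powR_gt0 // /schatten_norm.
have := singular_value_half_sub R N A B.
have := singular_value_ge0 R N (2^-1 *: (A - B)).
have := @singular_value_noninc R N B.
have := singular_value_ge0 R N B; have := singular_value_ge0 R N A.
move: (singular_value A) (singular_value B) (singular_value (2^-1 *: (A - B))).
move=> a b x a0 b0 bdec x0 xab; set S := \sum_(j < N) x j `^ q.
set SA := \sum_(j < N) a j `^ q; set SB := \sum_(j < N) b j `^ q.
have powR_mono (r : R) u v : 0 < r -> 0 <= u -> 0 <= v -> u <= v -> u `^ r <= v `^ r.
  by move=> r0 u0 v0 uv; apply: ge0_ler_powR => //; exact: ltW.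
have SA0 : 0 <= SA by apply: sumr_ge0 => j _; exact: powR_ge0.
have SB0 : 0 <= SB by apply: sumr_ge0 => j _; exact: powR_ge0.
have S0 : 0 <= S by apply: sumr_ge0 => j _; exact: powR_ge0.
have Sle : S <= 2 * (SA + SB).
  rewrite /SA /SB -big_split /=.
  apply: le_trans (sum_half_le _ N (fun k => a k `^ q + b k `^ q) _); last first.
    by move=> k; rewrite addr_ge0 ?powR_ge0.
  apply: ler_sum => j _.
  have xj : x j <= Num.max (a j./2) (b j./2).
    (* The index is split as j = j./2 + uphalf j. *)
    have := xab j./2 (uphalf j); rewrite addnC uphalf_half -addnA addnn odd_double_half.
    rewrite -uphalf_half => /le_trans; apply.
    have bj : b (uphalf j) <= b j./2 by apply: bdec; lia.
    by rewrite ge_max !le_max lexx bj orbT.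
  apply: (@le_trans _ _ (Num.max (a j./2) (b j./2) `^ q)).
    by apply: (powR_mono) => //; rewrite le_max a0.
  by rewrite maxEle; case: ifP => _; rewrite ?lerDl ?lerDr powR_ge0.
have [AB|BA] := leP SA SB.
  have SB4 : S <= 4 * SB by lra.
  apply: le_trans (powR_mono q^-1 _ _ _ S0 _ SB4) _; rewrite ?invr_gt0 ?mulr_ge0 //.
  by rewrite powRM // ler_pM2l ?powR_gt0 // le_max lexx orbT.
have SA4 : S <= 4 * SA by lra.
apply: le_trans (powR_mono q^-1 _ _ _ S0 _ SA4) _; rewrite ?invr_gt0 ?mulr_ge0 //.
by rewrite powRM // ler_pM2l ?powR_gt0 // le_max lexx.
Qed.

Lemma fine_inve_sub_ge0 (R : realType) (p q : \bar R) :
  (0 < p)%E -> (p <= q)%E -> 0 <= fine p^-1%E - fine q^-1%E.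
Proof.
case: p q => [p| |] [q| |] //=.
- rewrite lte_fin lee_fin => p0 pq; have q0 := lt_le_trans p0 pq.
  by rewrite !inver !gt_eqF //= subr_ge0 lef_pV2.
- rewrite lte_fin => p0 _; rewrite inver gt_eqF //= ?invey /= subr0 invr_ge0 ltW //.
Qed.

(** On matrices of rank at most [r], at most [r] singular values are nonzero, so
    the power mean inequality reverses the comparison of Schatten norms. *)
Lemma schatten_norm_rank_le (R : realType) (p q : \bar R) (N r : nat)
    (A : 'M[R]_N) :
  (0 < p)%E -> (p <= q)%E -> (\rank A <= r)%N ->
  schatten_norm p A <= r%:R `^ (fine p^-1%E - fine q^-1%E) * schatten_norm q A.
Proof.
move=> p0 pq Ar.
have := @singular_value_noninc R N A 0; have := singular_value_ge0 R N A.
have : forall j, (r <= j)%N -> singular_value A j = 0.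
  by move=> j rj; apply: singular_value_rank; exact: leq_trans rj.
rewrite /schatten_norm; move: (singular_value A) => s sr s0 sdec.
pose D := [set j : 'I_N | (j < r)%N].
have Dr : (#|D| <= r)%N.
  have [rN|Nr] := leqP r N; last by rewrite (leq_trans (max_card _)) // card_ord ltnW.
  by rewrite -sum1dep_card (big_ord_narrow rN) sum1_card card_ord.
have sD (j : 'I_N) : j \notin D -> s j = 0 by rewrite inE -leqNgt => /sr.
have powR_mono (e : R) u v : 0 <= e -> 0 <= u -> 0 <= v -> u <= v -> u `^ e <= v `^ e.
  by move=> e0 u0 v0 uv; apply: ge0_ler_powR.
case: p q p0 pq => [p| |] [q| |] //=.
- rewrite lte_fin lee_fin => p0 pq; have q0 := lt_le_trans p0 pq.
  rewrite !inver !gt_eqF //=.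
  have t01 : 0 < p / q <= 1 by rewrite divr_gt0 //= ler_pdivrMr // mul1r.
  have /andP[t0 t1] := t01.
  have := power_mean R _ D (fun j => s j `^ q) (p / q) (fun j => powR_ge0 _ _) _ t01.
  set T := \sum_(j < N) s j `^ q.
  have T0 : 0 <= T by apply: sumr_ge0 => j _; exact: powR_ge0.
  have -> : \sum_(j < N) (s j `^ q) `^ (p / q) = \sum_(j < N) s j `^ p.
    by apply: eq_bigr => j _; rewrite -powRrM mulrCA divff ?gt_eqF // mulr1.
  move=> /(_ _)/le_trans H.
  apply: (@le_trans _ _ ((r%:R `^ (1 - p / q) * T `^ (p / q)) `^ p^-1)).
    apply: (powR_mono); rewrite ?invr_ge0 ?mulr_ge0 ?powR_ge0 ?(ltW p0) //.
      by apply: sumr_ge0 => j _; exact: powR_ge0.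
    apply: H.
      by move=> j /sD ->; rewrite powR0 // gt_eqF.
    rewrite ler_wpM2r ?powR_ge0 // powR_mono ?subr_ge0 // ler_nat //.
  rewrite powRM ?powR_ge0 // -!powRrM mulrBl mul1r.
  by rewrite [p / q]mulrC -!mulrA divff ?gt_eqF // mulr1.
- rewrite lte_fin => p0 _; rewrite inver gt_eqF //= ?invey /= subr0.
  have Sle : \sum_(j < N) s j `^ p <= r%:R * s 0%N `^ p.
    apply: (@le_trans _ _ (\sum_(j in D) s 0%N `^ p)).
      rewrite [leRHS]big_mkcond; apply: ler_sum => j _; case: ifPn => [_|/sD ->].
        by apply: (powR_mono) => //; [exact: ltW | exact: sdec].
      by rewrite powR0 // gt_eqF.
    by rewrite sumr_const -[leLHS]mulr_natl ler_wpM2r ?powR_ge0 // ler_nat.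
  have S0 : 0 <= \sum_(j < N) s j `^ p by apply: sumr_ge0 => j _; exact: powR_ge0.
  apply: le_trans (powR_mono p^-1 _ _ _ S0 _ Sle) _; rewrite ?invr_ge0 ?(ltW p0) //.
    by rewrite mulr_ge0 ?powR_ge0.
  by rewrite powRM ?powR_ge0 // -powRrM divff ?gt_eqF // powRr1.
- by rewrite ?invey subrr powRr0 mul1r.
Qed.

(** * Information maps and recovery *)

(** The matrices supported on the first [r] columns are parametrized by row
    vectors of length [N * r]; the information map has a kernel on this space as
    soon as [m < N * r]. *)
Lemma exists_low_rank_kernel (R : realType) (N m r : nat) (A : 'I_m -> 'M[R]_N) :
  (m < N * r)%N -> (r <= N)%N ->
  exists X : 'M[R]_N, [/\ X != 0, (\rank X <= r)%N & info_map A X = 0].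
Proof.
move=> mNr rN; pose E : 'M[R]_(r, N) := pid_mx r.
pose ext (v : 'rV[R]_(N * r)) : 'M[R]_N := vec_mx v *m E.
pose K : 'M[R]_(N * r, m) := \matrix_(l, k) mx_inner (A k) (ext (delta_mx 0 l)).
have [v v0 vK] := exists_kernel _ _ _ K mNr.
have extE : ext v = \sum_l v 0 l *: ext (delta_mx 0 l).
  rewrite {1}[v]row_sum_delta /ext linear_sum mulmx_suml.
  by apply: eq_bigr => l _; rewrite linearZ -scalemxAl.
exists (ext v); split.
- apply: contra_neq v0 => ext0; apply: (can_inj (@vec_mxK R N r)).
  have Efree : row_free E by rewrite /row_free rank_pid_mx.
  by apply: (row_free_inj Efree); rewrite [LHS]ext0 linear0 mul0mx.
- exact: leq_trans (mxrankM_maxr _ _) (rank_leq_row _).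
- rewrite -vK; apply/rowP => k; rewrite !mxE extE /mx_inner.
  under [RHS]eq_bigr do rewrite mxE /mx_inner mulr_sumr.
  rewrite [RHS]exchange_big /=; apply: eq_bigr => i _.
  under [RHS]eq_bigr do rewrite mulr_sumr.
  rewrite [RHS]exchange_big /=; apply: eq_bigr => j _.
  rewrite summxE mulr_sumr; apply: eq_bigr => l _.
  by rewrite mxE mulrCA.
Qed.

Lemma info_mapZ (R : realType) (N m : nat) (A : 'I_m -> 'M[R]_N) (c : R)
    (X : 'M[R]_N) : info_map A (c *: X) = c *: info_map A X.
Proof.
apply/rowP => k; rewrite !mxE /mx_inner mulr_sumr; apply: eq_bigr => i _.
by rewrite mulr_sumr; apply: eq_bigr => j _; rewrite mxE mulrCA.
Qed.

Lemma min_ratio_le (R : realType) (N m : nat) :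
  (0 < N)%N -> (0 < m)%N ->
  Num.min 1 (N%:R / m%:R) <= 2 / (m %/ N).+1%:R :> R.
Proof.
move=> N0 m0; set r := (m %/ N).+1; set t : R := Num.min _ _.
have N0R : 0 < N%:R :> R by rewrite ltr0n.
have m0R : 0 < m%:R :> R by rewrite ltr0n.
have t1 : t <= 1 by rewrite ge_min lexx.
have tNm : t * m%:R <= N%:R by rewrite -ler_pdivlMr // ge_min lexx orbT.
have t0 : 0 <= t by rewrite le_min ler01 divr_ge0 ?ltW.
have rN : r%:R * N%:R <= m%:R + N%:R :> R.
  by rewrite -natrM -natrD ler_nat /r mulSn addnC leq_add2r leq_divM.
rewrite ler_pdivlMr ?ltr0n // -(ler_pM2r N0R); nra.
Qed.

(** [X] and [- X] have the same information, and the two errors of any common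
    recovery [Y] satisfy [X = ((X - Y) - (- X - Y)) / 2]. *)
Lemma worst_case_error_ge (R : realType) (p q : \bar R) (c : R) (N m : nat)
    (A : 'I_m -> 'M[R]_N) (Delta : 'rV[R]_m -> 'M[R]_N) (X : 'M[R]_N) :
  (forall Y Z : 'M[R]_N,
      c * schatten_norm q (2^-1 *: (Y - Z)) <=
        Num.max (schatten_norm q Y) (schatten_norm q Z)) ->
  schatten_norm p X <= 1 -> info_map A X = 0 ->
  ((c * schatten_norm q X)%:E <= worst_case_error p q A Delta)%E.
Proof.
move=> cP Xp AX; have AXN : info_map A (- X) = 0.
  by rewrite -scaleN1r info_mapZ AX scaler0.
have XE : X = 2^-1 *: ((X - Delta 0) - (- X - Delta 0)).
  by apply/matrixP => i j; rewrite !mxE; field.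
rewrite {1}XE; apply: (@le_trans _ _ (Num.max (schatten_norm q (X - Delta 0))
   (schatten_norm q (- X - Delta 0)))%:E); first by rewrite lee_fin.
rewrite EFin_max ge_max; apply/andP; split; apply: ereal_sup_ubound.
  by exists X => //; rewrite AX.
by exists (- X); [rewrite /schatten_ball /mkset schatten_normN | rewrite AXN].
Qed.

Theorem mainTheorem2 (R : realType) (p q : \bar R)
    (p_gt0 : (0 < p)%E) (p_le_q : (p <= q)%E) :
  exists c : R, 0 < c /\
    forall N m : nat, (1 <= m < N ^ 2)%N ->
      ((c * Num.min 1 (N%:R / m%:R) `^ (fine p^-1%E - fine q^-1%E))%:E
        <= @minimal_error R N m p q)%E.
Proof.
have [c [c0 cP]] := schatten_norm_half_sub R q (lt_le_trans p_gt0 p_le_q).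
have := fine_inve_sub_ge0 R p q p_gt0 p_le_q.
have := schatten_norm_rank_le R p q.
set e := _ - _ => norm_le e0.
(* The factor 2 `^ e pays for min 1 (N / m) <= 2 / r. *)
exists (c * (2 `^ e)^-1); split; first by rewrite mulr_gt0 ?invr_gt0 ?powR_gt0.
move=> N m /andP[m0 mN2].
have N0 : (0 < N)%N by case: N mN2.
set r := (m %/ N).+1.
have rN : (r <= N)%N by rewrite /r ltn_divLR // mulnn.
have mNr : (m < N * r)%N by rewrite mulnC ltn_ceil.
apply/ereal_infP => _ [A [Delta ->]].
have [X [X0 Xr AX]] := exists_low_rank_kernel R N m r A mNr rN.
have Xp := schatten_norm_gt0 R N p X p_gt0 X0.
set a := (schatten_norm p X)^-1.
have a0 : 0 < a by rewrite invr_gt0.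
have aXp : schatten_norm p (a *: X) = 1.
  by rewrite schatten_normZ // mulVf // gt_eqF.
have AaX : info_map A (a *: X) = 0 by rewrite info_mapZ AX scaler0.
have aXr : (\rank (a *: X)%R <= r)%N by rewrite mxrank_scale_nz // gt_eqF.
have aXq := norm_le N r (a *: X) p_gt0 p_le_q aXr.
apply: le_trans (worst_case_error_ge _ p _ _ _ _ _ Delta _ (cP N) _ AaX); last first.
  by rewrite aXp.
rewrite lee_fin -mulrA ler_pM2l // ler_pdivrMl ?powR_gt0 //.
move: aXq; rewrite aXp; set y := schatten_norm q _ => ry.
have r0 : 0 < r%:R :> R by rewrite ltr0n.
apply: (@le_trans _ _ ((2 / r%:R) `^ e)).
  apply: ge0_ler_powR => //; last exact: min_ratio_le.
    by rewrite nnegrE le_min ler01 divr_ge0.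
  by rewrite nnegrE divr_ge0.
rewrite powRM ?invr_ge0 ?(ltW r0) // ler_pM2l ?powR_gt0 //.
rewrite -(ler_pM2l (powR_gt0 e r0)) -powRM ?invr_ge0 ?(ltW r0) //.
by rewrite divff ?gt_eqF // powR1.
Qed.
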